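(* Fix an integer $n\ge 1$. There is a constant $C_n>0$ such that for every prime $p$ with $p\nmid n$, the proportion $I_{n,p}$ of monic degree-$n$ polynomials in $\mathbb{Z}_p[x]$ that are irreducible satisfies $$\left|I_{n,p}-\frac1n\right|\le C_n\,p^{-n/2}.$$ That is, $I_{n,p}=\frac1n+O(p^{-n/2})$ as $p\to\infty$.
   Context: A monic degree-$n$ polynomial $x^n+c_{n-1}x^{n-1}+\cdots+c_1x+c_0\in\mathbb{Z}_p[x]$ is identified with the point $(c_{n-1},\dots,c_0)\in\mathbb{Z}_p^n$, and $\mathbb{Z}_p^n$ carries the normalized Haar measure $\mu$ with $\mu(\mathbb{Z}_p^n)=1$. A polynomial is irreducible if it cannot be written as a product of two nonconstant polynomials in $\mathbb{Z}_p[x]$. The proportion of irreducible polynomials is the Haar measure of the set of irreducible monic degree-$n$ polynomials. *)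

(* Defs.v *)
From HB Require Import structures.
From mathcomp Require Import all_boot all_order all_algebra.
From mathcomp Require Import all_classical all_reals all_analysis.
Set Implicit Arguments. Unset Strict Implicit. Unset Printing Implicit Defensive.
Import Order.TTheory GRing.Theory Num.Theory.

(* p-adic integers Z_p as the inverse limit lim_k Z/p^k Z:            *)
(* an element is a sequence x with x k in {0,..,p^k-1} (x k is the    *)
(* residue mod p^k) and x (k+1) = x k  (mod p^k).                     *)
Definition is_padic (p : nat) (x : nat -> nat) : Prop :=
  forall k, (x k < p ^ k)%N /\ (x k.+1 %% p ^ k)%N = x k.

Definition padic0 : nat -> nat := fun _ => 0%N.
Definition padic1 (p : nat) : nat -> nat := fun k => (1 %% p ^ k)%N.

Definition padic_is_zero (x : nat -> nat) : Prop := forall k, x k = 0%N.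

Definition pcoef (s : seq (nat -> nat)) (i : nat) : nat -> nat :=
  nth padic0 s i.

Definition padic_poly (p : nat) (s : seq (nat -> nat)) : Prop :=
  forall i, is_padic p (pcoef s i).

Definition padic_poly_nonconst (s : seq (nat -> nat)) : Prop :=
  exists i, (0 < i)%N /\ ~ padic_is_zero (pcoef s i).

Definition pmul_coef (p : nat) (g h : seq (nat -> nat)) (i k : nat) : nat :=
  ((\sum_(j < i.+1) pcoef g j k * pcoef h (i - j) k) %% p ^ k)%N.

Definition monic_coef (p n : nat) (c : 'I_n -> nat -> nat) (i : nat)
  : nat -> nat :=
  match insub i with
  | Some j => c j
  | None => if i == n then padic1 p else padic0
  end.

Definition monic_reducible (p n : nat) (c : 'I_n -> nat -> nat) : Prop :=
  exists g h : seq (nat -> nat),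
    [/\ padic_poly p g, padic_poly p h,
        padic_poly_nonconst g, padic_poly_nonconst h &
        forall i k, monic_coef p c i k = pmul_coef p g h i k].

Definition monic_irreducible (p n : nat) (c : 'I_n -> nat -> nat) : Prop :=
  ~ monic_reducible p c.

(* Normalized Haar measure on Z_p^n, realized as the pushforward of   *)
(* Lebesgue measure on [0,1) under the base-p digit map: if           *)
(* x = sum_m d_m p^{-(m+1)} (d_m = floor(p^{m+1} x) mod p), then the  *)
(* coefficient c_j (j < n) is the p-adic integer sum_m d_{m n + j} p^m.*)
(* The digits d_m are i.i.d. uniform on {0..p-1} under Lebesgue       *)
(* measure, so the image measure is exactly Haar measure on Z_p^n.    *)
Local Open Scope ring_scope.

Definition pdigit {R : realType} (p : nat) (x : R) (m : nat) : nat :=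
  absz ((Num.floor (x * (p%:R ^+ m.+1))) %% (p%:Z))%Z.

Definition digits_to_coefs {R : realType} (p n : nat) (x : R)
  : 'I_n -> nat -> nat :=
  fun j k => (\sum_(m < k) pdigit p x (m * n + j) * p ^ m)%N.

Local Open Scope classical_set_scope.

Definition irred_set {R : realType} (p n : nat) : set R :=
  [set x : R | 0 <= x < 1 /\ @monic_irreducible p n (@digits_to_coefs R p n x)].

Definition prop_irred {R : realType} (p n : nat) : \bar R :=
  (@lebesgue_measure R) (irred_set p n).

(* Main.v *)
Require Import Defs.
From mathcomp Require Import all_boot all_order all_algebra all_field.
From mathcomp Require Import all_classical all_reals all_analysis.
From mathcomp Require Import zify ring lra.
Import Order.TTheory GRing.Theory Num.Theory.
Local Open Scope ring_scope.

(** Let [N] be the number of monic irreducible polynomials of degree [n] over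
    F_p.  A factorisation over Z_p of a monic polynomial has factors with unit
    leading coefficients, so it survives reduction mod [p]: a polynomial whose
    reduction is irreducible is irreducible.  Conversely, by Hensel's lemma the
    reduction of an irreducible polynomial has no factorisation into coprime
    nonconstant factors, so it is a power [q ^+ m] of an irreducible [q]; those
    with [m > 1] number [O(p^(n/2))] because [q] has degree at most [n/2].
    Since reduction mod [p] is equidistributed, the proportion is
    [N / p^n + O(p^(-n/2))].  Finally [N] is estimated in the field with [p^n]
    elements: the product of the irreducibles of degree [n] divides
    [X^(p^n) - X], and the elements of degree less than [n] lie in proper
    subfields, so that [p^n - n * p^(n/2) <= n * N <= p^n]. *)

(** * Polynomials over a field *)

(** Indexing by the vector of lower coefficients puts the monic polynomials of degree [n] over a
    finite field in bijection with a finite type, so that they can be counted. *)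
Definition monic_poly_of (F : nzRingType) n (v : 'rV[F]_n) : {poly F} :=
  'X^n + rVpoly v.

Lemma size_monic_poly_of (F : nzRingType) n (v : 'rV[F]_n) :
  size (monic_poly_of F n v) = n.+1.
Proof. by rewrite /monic_poly_of size_polyDl size_polyXn // ltnS size_poly. Qed.

Lemma monic_poly_of_monic (F : nzRingType) n (v : 'rV[F]_n) :
  monic_poly_of F n v \is monic.
Proof.
by rewrite monicE /monic_poly_of lead_coefDl ?lead_coefXn // size_polyXn ltnS size_poly.
Qed.

Lemma monic_poly_of_inj (F : nzRingType) n : injective (monic_poly_of F n).
Proof. by move=> u v /addrI /(can_inj rVpolyK). Qed.

Lemma monic_poly_of_surj (F : nzRingType) n (f : {poly F}) :
  f \is monic -> size f = n.+1 -> exists v : 'rV[F]_n, monic_poly_of F n v = f.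
Proof.
move=> fm sf; exists (poly_rV (f - 'X^n)).
have sd : (size (f - 'X^n)%R <= n)%N; last first.
  by rewrite /monic_poly_of (poly_rV_K sd) [LHS]addrC subrK.
apply/leq_sizeP => j; rewrite leq_eqVlt coefB coefXn => /predU1P[<-|nj].
  by move: fm; rewrite monicE lead_coefE sf eqxx => /eqP->; rewrite subrr.
by rewrite gtn_eqF // nth_default ?subrr // sf.
Qed.

(** Strong induction on the size: a nonconstant divisor not associate to [f] is smaller, and if
    there is none, [f] scaled to be monic is itself irreducible. *)
Lemma exists_irredp_dvd (F : fieldType) (f : {poly F}) :
  (1 < size f)%N -> exists q, [/\ irreducible_poly q, q \is monic & q %| f].
Proof.
elim: {f}(size f) {-2}f (leqnn (size f)) => [|s IH] f; first by case: (size f).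
move=> sf f1; have f0 : f != 0 by rewrite -size_poly_gt0 ltnW.
have [[g [g1 gf ngf]]|nex] :=
    pselect (exists g : {poly F}, [/\ size g != 1%N, g %| f & ~~ (g %= f)]).
  have gs : (size g < size f)%N.
    rewrite ltn_neqAle dvdp_leq // andbT; apply: contra ngf => /eqP e.
    by rewrite -dvdp_size_eqp // e.
  have g0 : g != 0 by apply: contraTneq gf => ->; rewrite dvd0p.
  have g1' : (1 < size g)%N by rewrite ltn_neqAle eq_sym g1 size_poly_gt0.
  have [|q [iq mq qg]] := IH g _ g1'; first by rewrite -ltnS (leq_trans gs).
  by exists q; split => //; apply: dvdp_trans gf.
have lf : lead_coef f != 0 by rewrite lead_coef_eq0.
have ef : (lead_coef f)^-1 *: f %= f by rewrite eqp_scale // invr_eq0.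
exists ((lead_coef f)^-1 *: f); split.
- split=> [|g g1]; first by rewrite size_scale ?invr_eq0.
  rewrite (eqp_dvdr _ ef) (eqp_sym g) => gf.
  apply/(eqp_trans ef); rewrite eqp_sym.
  by apply/negPn/negP => ng; apply: nex; exists g.
- by rewrite monicE lead_coefZ mulVf.
- by rewrite (eqp_dvdl _ ef).
Qed.

(** Split off the highest power [q ^+ m] of an irreducible factor. By maximality the cofactor is
    coprime to it, and it is either nonconstant or equal to 1. *)
Lemma monic_coprime_factorization (F : fieldType) (f : {poly F}) :
  f \is monic -> (1 < size f)%N ->
  (exists a b : {poly F}, [/\ a \is monic, b \is monic, coprimep a b,
     (1 < size a)%N && (1 < size b)%N & f = a * b]) \/
  (exists (q : {poly F}) (m : nat),
     [/\ irreducible_poly q, q \is monic & f = q ^+ m]).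
Proof.
move=> fm f1; have [q [iq mq qf]] := exists_irredp_dvd F f f1.
have f0 := monic_neq0 fm; have q1 : (1 < size q)%N := iq.1.
have sqm i : size (q ^+ i) = (i * (size q).-1).+1.
  by rewrite mulnC -size_exp prednK // size_poly_gt0 monic_neq0 // rpredX.
have exP : exists i, q ^+ i %| f by exists 1%N; rewrite expr1.
have bP i : q ^+ i %| f -> (i <= size f)%N.
  move=> /dvdp_leq - /(_ f0); rewrite sqm => h.
  apply: leq_trans (ltnW h); rewrite leq_pmulr //; lia.
case: (ex_maxnP exP bP) => m qmf mmax.
have m0 : (0 < m)%N by apply: mmax; rewrite expr1.
have [r fE] := dvdpP _ _ qmf; rewrite mulrC in fE.
have mqm : q ^+ m \is monic by rewrite rpredX.
have rm : r \is monic by rewrite -(monicMl _ mqm) -fE.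
have cop : coprimep (q ^+ m) r.
  rewrite coprimep_expl // irreducible_poly_coprime //; apply/negP => /dvdpP[t tE].
  have : q ^+ m.+1 %| f by rewrite fE tE exprSr dvdp_mul ?dvdp_mulIr.
  by move/mmax; rewrite ltnn.
have [r1|r1] := leqP (size r) 1.
  right; exists q, m; split=> //; rewrite fE.
  suff -> : r = 1 by rewrite mulr1.
  apply/eqP; rewrite -(eqp_monic rm (monic1 _)) -size_poly_eq1 eqn_leq r1.
  by rewrite size_poly_gt0 monic_neq0.
left; exists (q ^+ m), r; split => //; rewrite r1 andbT sqm ltnS.
by rewrite muln_gt0 m0; lia.
Qed.

(** Multiply a Bezout relation by [e] and reduce the coefficient of [b] modulo [a], moving the
    quotient into the coefficient of [a]. *)
Lemma bezout_small (F : fieldType) (a b e : {poly F}) :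
  coprimep a b -> a != 0 -> b != 0 -> (size e < (size a + size b).-1)%N ->
  exists u v : {poly F},
    [/\ e = u * b + v * a, (size u < size a)%N & (size v < size b)%N].
Proof.
move=> cop a0 b0 se; have [[u0 v0] /= w1] := Bezout_coprimepP _ _ cop.
have [c c0 wE] : exists2 c : F, c != 0 & u0 * a + v0 * b = c%:P.
  have : size (u0 * a + v0 * b) == 1%N by rewrite size_poly_eq1.
  by move/size_poly1P.
pose k := (c^-1)%:P; have eE0 : e = k * (e * (u0 * a + v0 * b)).
  by rewrite wE mulrCA -polyCM mulVf // mulr1.
pose x := k * (e * v0); pose u := x %% a; pose v := k * (e * u0) + x %/ a * b.
have eE : e = u * b + v * a.
  have -> : u = x - x %/ a * a 
    by apply/eqP; rewrite eq_sym subr_eq addrC -divp_eq.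
  by rewrite /v {1}eE0 /x; ring.
exists u, v; have su : (size u < size a)%N by rewrite ltn_modp.
(* The bound on [v] is forced: both terms of [v * a = e - u * b] on the right have size less than
   [(size a + size b).-1]. *)
split=> //; have [->|v0'] := eqVneq v 0; first by rewrite size_poly0 size_poly_gt0.
have /eqP : v * a = e - u * b by rewrite eE addrAC subrr add0r.
move=> /eqP /(congr1 (fun t : {poly F} => size t)); rewrite size_mul // => sE.
have h1 := size_polyD e (- (u * b)); have h2 := size_polyMleq u b.
rewrite size_polyN -sE in h1; have sa : (0 < size a)%N by rewrite size_poly_gt0.
have sb : (0 < size b)%N by rewrite size_poly_gt0.
by move: (size v) (size u) (size a) (size b) (size e) (size (u * b)) h1 h2 sa sb su se; lia.
Qed.

(** * Counting irreducible polynomials over F_p *)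

(** Distinct monic irreducibles are coprime, so Gauss's lemma applies one factor at a time. *)
Lemma dvdp_prod_irredp (F : fieldType) (s : seq {poly F}) (Q : {poly F}) :
  uniq s -> (forall g, g \in s -> irreducible_poly g /\ g \is monic) ->
  (forall g, g \in s -> g %| Q) -> \prod_(g <- s) g %| Q.
Proof.
elim: s => [|g s IH] /=; first by rewrite big_nil dvd1p.
move=> /andP[gs us] irr dv; rewrite big_cons Gauss_dvdp; last first.
  rewrite big_seq; apply: (big_ind (coprimep g)) => [|x y|h hs].
  - by rewrite coprimep1.
  - by rewrite coprimepMr => -> ->.
  - have [ig mg] := irr g (mem_head _ _).
    have [ih mh] : irreducible_poly h /\ h \is monic.
      by apply: irr; rewrite inE hs orbT.
    rewrite irreducible_poly_coprime //; apply/negP => gh.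
    move: (ih) => [_ /(_ g)]; rewrite gh gtn_eqF ?ig.1 // => /(_ isT isT).
    by rewrite eqp_monic // => /eqP e; rewrite e hs in gs.
rewrite dv ?mem_head //= IH // => h hs; [apply: irr|apply: dv];
  by rewrite inE hs orbT.
Qed.

(** Adjoining a root of [g] gives a field with [#|F| ^ n] elements. By Fermat this root is also a
    root of ['X^(#|F| ^ n) - 'X], so the two polynomials are not coprime. *)
Lemma irredp_dvd_XqX (F : finFieldType) (g : {poly F}) n :
  irreducible_poly g -> size g = n.+1 -> g %| 'X^(#|F| ^ n) - 'X.
Proof.
move=> ig sg; have [L dL [z rz _]] := irredp_FAdjoin ig.
have := memvf z; rewrite (Fermat's_little_theorem (aspacef L)) dL sg /= => /eqP zq.
apply/negPn/negP; rewrite -irreducible_poly_coprime // => /coprimepP cop.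
have : coprimep (map_poly (in_alg L) g) (map_poly (in_alg L) ('X^(#|F| ^ n) - 'X)).
  by rewrite coprimep_map; apply/coprimepP.
move/coprimep_root => /(_ _ rz).
by rewrite rmorphB /= map_polyXn map_polyX !hornerE zq subrr eqxx.
Qed.

(** Compare degrees: the product of these polynomials has degree [n * #|I|] and divides
    ['X^(#|F| ^ n) - 'X]. *)
Lemma card_irred_monic_le (F : finFieldType) n
  (I : {set 'rV[F]_n}) : (0 < n)%N ->
  (forall v, v \in I -> irreducible_poly (monic_poly_of F n v)) ->
  (n * #|I| <= #|F| ^ n)%N.
Proof.
move=> n0 irr; pose s := [seq monic_poly_of F n v | v <- enum I].
have q1 : (1 < #|F| ^ n)%N by rewrite -(exp1n n) ltn_exp2r // finNzRing_gt1.
have sQ : size ('X^(#|F| ^ n) - 'X : {poly F}) = (#|F| ^ n).+1.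
  by rewrite size_polyDl size_polyXn // size_polyN size_polyX.
have := dvdp_prod_irredp F s ('X^(#|F| ^ n) - 'X).
rewrite map_inj_uniq ?enum_uniq; last exact: monic_poly_of_inj.
have h g : g \in s -> irreducible_poly g /\ size g = n.+1 /\ g \is monic.
  move=> /mapP[v]; rewrite mem_enum => vI ->; split; first exact: irr.
  by rewrite size_monic_poly_of monic_poly_of_monic.
move=> /(_ isT) H; have {}H : \prod_(g <- s) g %| 'X^(#|F| ^ n) - 'X.
  apply: H => g /h [ig [sg mg]] //; exact: irredp_dvd_XqX.
have /dvdp_leq := H; rewrite -size_poly_eq0 sQ => /(_ isT).
rewrite big_map big_enum /= size_prod; last first.
  by move=> v _; rewrite monic_neq0 ?monic_poly_of_monic.
under eq_bigr do rewrite size_monic_poly_of.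
rewrite sum_nat_const.
have := cardE I. set k := #|I|. lia.
Qed.

Lemma card_bigcup_le (I T : finType) (P : pred I) (F : I -> {set T}) :
  (#|\bigcup_(i | P i) F i| <= \sum_(i | P i) #|F i|)%N.
Proof.
elim/big_rec2: _ => [|i m A _ IH]; first by rewrite cards0.
by apply: leq_trans (leq_card_setU _ _) _; rewrite leq_add2l.
Qed.

Lemma card_roots_le (F : finFieldType) (q : {poly F}) m :
  q != 0 -> (size q <= m.+1)%N -> (#|[set x | root q x]| <= m)%N.
Proof.
move=> q0 sq; rewrite -ltnS; apply: leq_trans sq; rewrite cardE.
apply: max_poly_roots => //; last by rewrite enum_uniq.
by apply/allP => x; rewrite mem_enum inE.
Qed.

(** Count the field [L] with [p ^ n] elements. An element of degree [n] is one of at most [n] roots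
    of its minimal polynomial. Any other element has as degree a proper divisor [d] of [n], so
    [d <= n./2], and is a root of ['X^(p ^ d) - 'X]. *)
Lemma card_irred_monic_ge (p n : nat)
  (I : {set 'rV['F_p]_n}) : prime p -> (0 < n)%N ->
  (forall v, irreducible_poly (monic_poly_of 'F_p n v) -> v \in I) ->
  (p ^ n <= n * #|I| + n * p ^ n./2)%N.
Proof.
move=> pp n0 irr; have [L0 pL cL] := pPrimePowerField pp n0.
pose L := pPrimeCharType pL.
have cardL : #|L| = (p ^ n)%N by [].
have dimL : \dim {:L} = n by rewrite pprimeChar_dimf cL pfactorK.
pose A := [set x : L | adjoin_degree 1 x == n].
have cA : (#|A| <= n * #|I|)%N.
  have : A \subset \bigcup_(v in I) [set x | root (map_poly (in_alg L) (monic_poly_of _ _ v)) x].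
    apply/fintype.subsetP => x; rewrite inE => /eqP dx.
    have /polyOver1P[q Dq] := minPolyOver 1 x.
    have mq : q \is monic by rewrite -(map_monic (in_alg L)) -Dq monic_minPoly.
    have sq : size q = n.+1 by rewrite -(size_map_poly (in_alg L)) -Dq size_minPoly dx.
    have [v vq] := monic_poly_of_surj _ _ _ mq sq.
    apply/bigcupP; exists v; last by rewrite inE vq -Dq root_minPoly.
    apply: irr; rewrite vq; split=> [|h sh hq]; first by rewrite sq.
    have : (map_poly (in_alg L) h %= minPoly 1 x) || (map_poly (in_alg L) h %= 1).
      apply: minPoly_irr; last by rewrite Dq dvdp_map.
      by apply/polyOver1P; exists h.
    rewrite Dq eqp_map => /orP[//|/eqp_size].
    by rewrite size_map_poly size_poly1 => e; rewrite e in sh.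
  move/subset_leq_card/leq_trans; apply; apply: (leq_trans (card_bigcup_le _ _ _ _)).
  rewrite -sum1_card big_distrr /=; apply: leq_sum => v _; rewrite muln1.
  apply: card_roots_le; last by rewrite size_map_poly size_monic_poly_of.
  by rewrite map_poly_eq0 monic_neq0 ?monic_poly_of_monic.
have cB : (#|~: A| <= n * p ^ n./2)%N.
  (* Degrees start at 1, so the index [d] stands for the degree [d.+1]. *)
  have : ~: A \subset \bigcup_(d : 'I_n./2) [set x | root ('X^(p ^ d.+1) - 'X) x].
    apply/fintype.subsetP => x; rewrite !inE => dx.
    pose d := adjoin_degree 1%VS x.
    have dE : \dim <<1; x>> = d by rewrite dim_Fadjoin dimv1 muln1.
    have d0 : (0 < d)%N by rewrite -dE adim_gt0.
    have dn : (d %| n)%N.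
      by rewrite -dE -dimL; apply: (@field_dimS _ _ <<1; x>>%AS (aspacef L)); apply: subvf.
    have d2 : (d <= n./2)%N.
      case/dvdnP: dn => k nE; have k2 : (2 <= k)%N.
        case: k nE => [|[|//]] nE; first by rewrite nE in n0.
        by move: dx; rewrite -/d nE mul1n eqxx.
      have : (2 * d <= n)%N by rewrite nE leq_mul2r k2 orbT.
      by lia.
    have d2' : (d.-1 < n./2)%N by rewrite (prednK d0).
    apply/bigcupP; exists (Ordinal d2') => //; rewrite inE /= (prednK d0).
    have := memv_adjoin 1 x; rewrite Fermat's_little_theorem dE card_Fp // => /eqP e.
    by rewrite rootE !hornerE subr_eq0; apply/eqP; exact: e.
  move/subset_leq_card/leq_trans; apply; apply: (leq_trans (card_bigcup_le _ _ _ _)).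
  apply: (@leq_trans (\sum_(d < n./2) p ^ n./2)); last first.
    by rewrite sum_nat_const card_ord leq_mul2r; apply/orP; right; lia.
  apply: leq_sum => d _; have p1 := prime_gt1 pp.
  have q1 : (1 < p ^ d.+1)%N by rewrite -(exp1n d.+1) ltn_exp2r.
  have s : size ('X^(p ^ d.+1) - 'X : {poly L}) = (p ^ d.+1).+1.
    by rewrite size_polyDl size_polyXn // size_polyN size_polyX.
  apply: (@leq_trans (p ^ d.+1)); last by rewrite leq_exp2l.
  by apply: card_roots_le; rewrite ?s // -size_poly_eq0 s.
by rewrite -cardL -(cardsC A) leq_add.
Qed.

(** * Hensel lifting *)

Section Hensel.
Variable p : nat.
Hypothesis p_pr : prime p.

Local Notation red := (map_poly (intr : int -> 'F_p)).

(** The representative in [[0, p - 1]]. It respects neither sums nor products, but fixes 0 and 1, so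
    the lift of a polynomial keeps size bounds and monicity. *)
Definition Fp_int (x : 'F_p) : int := (x : nat)%:Z.

Definition lift_poly (u : {poly 'F_p}) : {poly int} := map_poly Fp_int u.

Lemma lift_polyK u : red (lift_poly u) = u.
Proof.
apply/polyP => i; rewrite coef_map /= coef_map_id0 //=.
by rewrite -pmulrn; exact: natr_Zp.
Qed.

Lemma size_lift_poly u : (size (lift_poly u) <= size u)%N.
Proof. exact: size_poly. Qed.

Lemma lift_poly_monic u : u \is monic -> lift_poly u \is monic.
Proof.
move=> um; have u0 := monic_neq0 um; have lu := monicP um.
have F1 : Fp_int 1 = 1.
  by rewrite /Fp_int -[1]/(1%:R) val_Fp_nat // modn_small ?prime_gt1.
rewrite monicE [lift_poly u]/(\poly_(i < size u) Fp_int u`_i).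
by rewrite lead_coef_poly ?size_poly_gt0 // -?lead_coefE lu F1.
Qed.

Lemma red_eq0 (P : {poly int}) : red P = 0 -> exists W, P = p%:Z *: W.
Proof.
move=> P0; exists (map_poly (fun z => (z %/ p)%Z) P).
apply/polyP => i; rewrite coefZ coef_map_id0 ?div0z // mulrC divzK //.
rewrite (dvdz_pcharf (pchar_Fp p_pr)) -[_%:~R]/((intr : int -> 'F_p) _).
by rewrite -(coef_map (intr : {rmorphism int -> 'F_p})) P0 coef0.
Qed.

Lemma size_red_monic (P : {poly int}) : P \is monic -> size (red P) = size P.
Proof. by move=> /monicP lP; rewrite size_map_poly_id0 // lP oner_eq0. Qed.

(** The target moves from [F] to [F'] along with the precision. The corrections solve
    [G * V + H * U = E + D] modulo [p]; being smaller than [G] and [H], they leave the leading terms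
    unchanged. *)
Lemma hensel_step (a b : {poly 'F_p}) k n (F F' G H D E : {poly int}) :
  coprimep a b -> (0 < k)%N ->
  F' \is monic -> size F' = n.+1 -> (size a + size b = n.+2)%N ->
  G \is monic -> H \is monic -> red G = a -> red H = b ->
  F = G * H + (p ^ k)%:Z *: E -> F' = F + (p ^ k)%:Z *: D ->
  exists G' H' : {poly int},
    [/\ G' \is monic, H' \is monic, red G' = a, red H' = b &
        [/\ exists E', F' = G' * H' + (p ^ k.+1)%:Z *: E',
            exists U, G' = G + (p ^ k)%:Z *: U &
            exists V, H' = H + (p ^ k)%:Z *: V]].
Proof.
move=> cop k0 F'm sF' sab Gm Hm rG rH FE F'E.
have pk0 : (p ^ k)%:Z != 0 by rewrite eqz_nat expn_eq0 negb_and -lt0n prime_gt0.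
have sG : size G = size a by rewrite -rG size_red_monic.
have sH : size H = size b by rewrite -rH size_red_monic.
have a0 : a != 0 by rewrite -size_poly_gt0 -sG size_poly_gt0 monic_neq0.
have b0 : b != 0 by rewrite -size_poly_gt0 -sH size_poly_gt0 monic_neq0.
have GHm : G * H \is monic by rewrite monicMl.
have sGH : size (G * H) = n.+1.
  by rewrite size_monicM ?monic_neq0 // sG sH sab.
have F'GH : F' = G * H + (p ^ k)%:Z *: (E + D) by rewrite F'E FE scalerDr addrA.
(* The terms of degree [n] cancel because [F'] and [G * H] are both monic of that degree; this gives
   the size bound that [bezout_small] requires. *)
have sE : (size (E + D)%R <= n)%N.
  apply/leq_sizeP => j nj; apply: (mulfI pk0); rewrite mulr0 -coefZ.
  have -> : (p ^ k)%:Z *: (E + D) = F' - G * H by rewrite F'GH addrAC subrr add0r.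
  rewrite coefB; move: nj; rewrite leq_eqVlt => /predU1P[<-|nj].
    have := monicP GHm; have := monicP F'm; rewrite !lead_coefE sF' sGH /= => -> ->.
    by rewrite subrr.
  by rewrite !nth_default ?subrr // ?sF' ?sGH.
have [|u [v [euv su sv]]] := bezout_small _ a b (red (E + D)) cop a0 b0.
  by rewrite sab /= ltnS (leq_trans (size_poly _ _)).
pose U := lift_poly u; pose V := lift_poly v.
have sU : (size U < size G)%N by rewrite sG (leq_ltn_trans (size_lift_poly _)).
have sV : (size V < size H)%N by rewrite sH (leq_ltn_trans (size_lift_poly _)).
have redk (P : {poly int}) : red ((p ^ k)%:Z *: P) = 0.
  rewrite map_polyZ /=; case: k k0 {pk0 sE F'GH FE F'E} => // k _.
  by rewrite expnS PoszM intrM -pmulrn pchar_Fp_0 // mul0r scale0r.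
have [W WE] : exists W, E + D - (G * V + H * U) = p%:Z *: W.
  apply: red_eq0; rewrite rmorphB /= euv rmorphD /=.
  rewrite !rmorphM /= rG rH !lift_polyK.
  by ring.
exists (G + (p ^ k)%:Z *: U), (H + (p ^ k)%:Z *: V); split.
- by rewrite monicE lead_coefDl ?size_scale // (monicP Gm).
- by rewrite monicE lead_coefDl ?size_scale // (monicP Hm).
- by rewrite rmorphD /= redk addr0.
- by rewrite rmorphD /= redk addr0.
split; [|by exists U|by exists V].
(* [p ^ k.+1 * p ^ k.-1 = p ^ (2 * k)] absorbs the quadratic error term. *)
exists (W - (p ^ k.-1)%:Z *: (U * V)).
have -> : F' = G * H + (p ^ k)%:Z *: (G * V + H * U) + (p ^ k)%:Z *: (p%:Z *: W).
  by rewrite -WE F'GH -addrA -scalerDr; congr (_ + _ *: _); ring.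
have pE : (p ^ k.+1)%:Z = (p ^ k)%:Z * p%:Z by rewrite expnSr PoszM.
have kE : (p ^ k)%:Z = p%:Z * (p ^ k.-1)%:Z by rewrite -PoszM -expnS prednK.
rewrite pE scalerBr !scalerA -mulrA -kE -!mul_polyC !rmorphM /=.
by ring.
Qed.

(** Indices are shifted by one: [G k] and [H k] factor [F k.+1] modulo [p ^ k.+1]. Modulo [p ^ 0]
    every residue is 0, so monicity makes sense only from [F 1] on. *)
Lemma hensel n (a b : {poly 'F_p}) (F : nat -> {poly int}) :
  a \is monic -> b \is monic -> coprimep a b -> (size a + size b = n.+2)%N ->
  (forall k, F k.+1 \is monic) -> (forall k, size (F k.+1) = n.+1) ->
  (forall k, exists D, F k.+2 = F k.+1 + (p ^ k.+1)%:Z *: D) ->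
  red (F 1%N) = a * b ->
  exists G H : nat -> {poly int}, forall k,
    [/\ G k \is monic, H k \is monic, red (G k) = a, red (H k) = b &
        [/\ exists E, F k.+1 = G k * H k + (p ^ k.+1)%:Z *: E,
            exists U, G k.+1 = G k + (p ^ k.+1)%:Z *: U &
            exists V, H k.+1 = H k + (p ^ k.+1)%:Z *: V]].
Proof.
move=> am bm cop sab Fm sF FD F1.
pose Inv k (s : {poly int} * {poly int}) :=
  [/\ s.1 \is monic, s.2 \is monic, red s.1 = a, red s.2 = b &
      exists E, F k.+1 = s.1 * s.2 + (p ^ k.+1)%:Z *: E].
pose Step k (s t : {poly int} * {poly int}) :=
  Inv k s -> [/\ Inv k.+1 t,
    exists U, t.1 = s.1 + (p ^ k.+1)%:Z *: U &
    exists V, t.2 = s.2 + (p ^ k.+1)%:Z *: V].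
(* [Step] assumes the invariant instead of carrying it in a type, so choice yields a total function;
   pairs violating the invariant are sent to themselves. *)
have [|f fP] := @choice (nat * ({poly int} * {poly int})) _ (fun x => Step x.1 x.2).
  move=> [k [G H]].
  have [[/= Gm Hm rG rH [E FE]]|nI] := pselect (Inv k (G, H)); last by exists (G, H).
  have [D FE'] := FD k.
  have [G' [H' [? ? ? ? [? ? ?]]]] := hensel_step a b k.+1 n _ _ G H D E cop isT
    (Fm k.+1) (sF k.+1) sab Gm Hm rG rH FE FE'.
  by exists (G', H').
pose s := fix s k := if k is k'.+1 then f (k', s k')
  else (lift_poly a, lift_poly b).
have Is k : Inv k (s k).
  elim: k => [|k IH]; last by have [] := fP (k, s k) IH.
  split; rewrite /= ?lift_polyK ?lift_poly_monic //.
  have [|W WE] := red_eq0 (F 1%N - lift_poly a * lift_poly b).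
    by rewrite rmorphB rmorphM /= !lift_polyK F1 subrr.
  by exists W; rewrite expn1 -WE addrC subrK.
exists (fun k => (s k).1), (fun k => (s k).2) => k.
by have [? ? ? ? ?] := Is k; have [_ ? ?] := fP (k, s k) (Is k).
Qed.

End Hensel.

(** * Reduction modulo [p] and factorisations over Z_p *)

Definition reduction (p n : nat) (c : 'I_n -> nat -> nat) : 'rV['F_p]_n :=
  \row_j (c j 1%N)%:R.

Lemma coef_monic_poly_of_reduction p n (c : 'I_n -> nat -> nat) i : prime p ->
  (monic_poly_of _ _ (reduction p n c))`_i = (monic_coef p c i 1)%:R.
Proof.
move=> pp; rewrite /monic_poly_of coefD coefXn /monic_coef.
case: insubP => [j jn ji|nin].
  rewrite -ji coef_rVpoly_ord mxE.
  by have := ltn_ord j; rewrite ltn_neqAle => /andP[/negPf-> _]; rewrite add0r.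
rewrite [X in _ + X]nth_default ?addr0; last first.
  by rewrite (leq_trans (size_poly _ _)) // leqNgt.
case: eqP => //= _; by rewrite /padic1 expn1 modn_small ?prime_gt1.
Qed.

Lemma is_padic0 p : (0 < p)%N -> is_padic p padic0.
Proof. by move=> p0 k; rewrite /padic0 expn_gt0 p0 mod0n. Qed.

Lemma is_padic1 p : (0 < p)%N -> is_padic p (padic1 p).
Proof.
move=> p0 k; rewrite /padic1 ltn_pmod ?expn_gt0 ?p0 //.
by rewrite modn_dvdm // dvdn_exp2l.
Qed.

Lemma is_padic_monic_coef p n (c : 'I_n -> nat -> nat) : (0 < p)%N ->
  (forall j, is_padic p (c j)) -> forall i, is_padic p (monic_coef p c i).
Proof.
move=> p0 cp i; rewrite /monic_coef; case: insubP => [j _ _|_]; first exact: cp.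
by case: eqP => _; [apply: is_padic1|apply: is_padic0].
Qed.

Lemma is_padic_mod p x k l : is_padic p x -> (x (k + l) %% p ^ k)%N = x k.
Proof.
move=> xp; elim: l => [|l IH]; first by rewrite addn0 modn_small // (xp k).1.
rewrite addnS -IH -(xp (k + l)%N).2 modn_dvdm //.
by rewrite dvdn_exp2l ?leq_addr.
Qed.

(** Valuations add: [x] has valuation less than [k] and [y] less than [l], so the product has
    valuation less than [k + l]. *)
Lemma padic_mul_neq0 p x y k l : prime p -> is_padic p x -> is_padic p y ->
  x k <> 0%N -> y l <> 0%N -> ((x (k + l) * y (k + l)) %% p ^ (k + l))%N <> 0%N.
Proof.
move=> pp xp yp xk yl /eqP; apply/negP.
have nx : ~~ (p ^ k %| x (k + l))%N by rewrite /dvdn is_padic_mod //; apply/eqP.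
have ny : ~~ (p ^ l %| y (k + l))%N by rewrite /dvdn addnC is_padic_mod //; apply/eqP.
have x0 : (0 < x (k + l))%N by case: (x _) nx; rewrite ?dvdn0.
have y0 : (0 < y (k + l))%N by case: (y _) ny; rewrite ?dvdn0.
move: nx ny; rewrite -/(_ %| _)%N !pfactor_dvdn ?muln_gt0 ?x0 //.
by rewrite lognM //; lia.
Qed.

(** The list may end in zero coefficients, so the degree is the largest index of a nonzero one; the
    length of the list only bounds it. *)
Lemma padic_poly_lead s : padic_poly_nonconst s ->
  exists a, [/\ (0 < a)%N, exists k, pcoef s a k <> 0%N &
    forall i k, (a < i)%N -> pcoef s i k = 0%N].
Proof.
move=> [i [i0 si]]; pose P i := `[< ~ padic_is_zero (pcoef s i) >].
have exP : exists i, P i by exists i; apply/asboolP.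
have bP j : P j -> (j <= size s)%N.
  move=> /asboolP sj; rewrite leqNgt; apply/negP => js; apply: sj => k.
  by rewrite /pcoef nth_default // ltnW.
case: (ex_maxnP exP bP) => a /asboolP Pa amax; exists a; split.
- by apply: leq_trans i0 _; apply: amax; apply/asboolP.
- by apply/existsNP => h; apply: Pa.
- move=> j k aj; apply/eqP/negPn/negP => jk.
  have : (j <= a)%N by apply: amax; apply/asboolP => /(_ k) /eqP; apply/negP.
  by rewrite leqNgt aj.
Qed.

(** The factors need not be monic, but the product of their leading coefficients is 1, so both keep
    their positive degrees modulo [p]. *)
Lemma monic_reducible_modp p n (c : 'I_n -> nat -> nat) : prime p ->
  monic_reducible p c ->
  ~ irreducible_poly (monic_poly_of _ _ (reduction p n c)).
Proof.
move=> pp [g [h [gp hp gn hn gh]]] [_ irr]; have p0 := prime_gt0 pp.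
have [a [a0 [k gk] ga]] := padic_poly_lead g gn.
have [b [b0 [l hl] hb]] := padic_poly_lead h hn.
have top m : pmul_coef p g h (a + b) m = ((pcoef g a m * pcoef h b m) %% p ^ m)%N.
  have aab : (a < (a + b).+1)%N by rewrite ltnS leq_addr.
  rewrite /pmul_coef (bigD1 (Ordinal aab)) //= addKn big1 ?addn0 // => j ja.
  have {}ja : (j : nat) != a by apply: contra ja => /eqP e; apply/eqP/val_inj.
  have [aj|ja'] := ltnP a j; first by rewrite ga.
  by rewrite hb ?muln0 //; lia.
(* Z_p is a domain, so the leading coefficients of [g] and [h] have a nonzero
   product; comparing with the monic polynomial, this product is 1. *)
have abn : (a + b <= n)%N.
  rewrite leqNgt; apply/negP => nab.
  apply: (padic_mul_neq0 p _ _ k l pp (gp a) (hp b) gk hl).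
  rewrite -top -gh /monic_coef insubF; last by apply/negbTE; rewrite -leqNgt ltnW.
  by rewrite gtn_eqF.
have cn : monic_coef p c n 1 = 1%N.
  by rewrite /monic_coef insubF ?ltnn // eqxx /padic1 expn1 modn_small ?prime_gt1.
have abE : (a + b)%N = n.
  apply/eqP; rewrite eqn_leq abn leqNgt; apply/negP => abn'.
  have : monic_coef p c n 1 = 0%N.
    rewrite gh /pmul_coef big1 ?mod0n // => j _.
    have [aj|ja] := ltnP a j; first by rewrite ga.
    by rewrite hb ?muln0 //; lia.
  by rewrite cn.
pose A : {poly 'F_p} := \poly_(i < a.+1) (pcoef g i 1)%:R.
pose B : {poly 'F_p} := \poly_(i < b.+1) (pcoef h i 1)%:R.
have Ai i : A`_i = (pcoef g i 1)%:R.
  by rewrite coef_poly ltnS; case: leqP => // ai; rewrite ga.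
have Bi i : B`_i = (pcoef h i 1)%:R.
  by rewrite coef_poly ltnS; case: leqP => // bi; rewrite hb.
have AB1 : A`_a * B`_b = 1.
  rewrite Ai Bi -natrM -(Fp_nat_mod pp); have := top 1%N; rewrite expn1 => <-.
  by rewrite -gh abE cn.
have sA : size A = a.+1.
  apply: size_poly_eq; rewrite -Ai; apply/eqP => e.
  by move/eqP: AB1; rewrite e mul0r eq_sym oner_eq0.
have sB : size B = b.+1.
  apply: size_poly_eq; rewrite -Bi; apply/eqP => e.
  by move/eqP: AB1; rewrite e mulr0 eq_sym oner_eq0.
have fE : monic_poly_of _ _ (reduction p n c) = A * B.
  apply/polyP => i; rewrite coef_monic_poly_of_reduction // gh /pmul_coef expn1.
  rewrite Fp_nat_mod // natr_sum coefM; apply: eq_bigr => j _.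
  by rewrite natrM Ai Bi.
have := irr A; rewrite fE sA dvdp_mulIl eqSS -lt0n a0 => /(_ isT isT).
rewrite -dvdp_size_eqp ?dvdp_mulIl // -fE sA size_monic_poly_of -abE eqSS => /eqP.
lia.
Qed.

(** Hensel's lemma is applied to the integer polynomials [F k] made of the residues modulo [p ^ k];
    the p-adic coefficients of the factors are then read off from the successive lifts. *)
Lemma hensel_reducible p n (c : 'I_n -> nat -> nat) (a b : {poly 'F_p}) :
  prime p -> (forall j, is_padic p (c j)) ->
  a \is monic -> b \is monic -> coprimep a b -> (1 < size a)%N -> (1 < size b)%N ->
  monic_poly_of _ _ (reduction p n c) = a * b -> monic_reducible p c.
Proof.
move=> pp cp am bm cop a1 b1 fE; have p0 := prime_gt0 pp.
have mcp := is_padic_monic_coef p n c p0 cp.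
have sab : (size a + size b = n.+2)%N.
  have := size_monic_poly_of _ _ (reduction p n c); rewrite fE size_monicM ?monic_neq0 //.
  by move: (size a) (size b) a1 b1; lia.
pose F k : {poly int} := \poly_(i < n.+1) (monic_coef p c i k)%:Z.
have mc0 i k : (n < i)%N -> monic_coef p c i k = 0%N.
  move=> ni; rewrite /monic_coef insubF ?gtn_eqF //.
  by apply/negbTE; rewrite -leqNgt ltnW.
have Fi k i : (F k)`_i = (monic_coef p c i k)%:Z.
  by rewrite coef_poly ltnS; case: leqP => // ni; rewrite mc0.
have cn k : monic_coef p c n k.+1 = 1%N.
  rewrite /monic_coef insubF ?ltnn // eqxx /padic1 modn_small //.
  by rewrite -(exp1n k.+1) ltn_exp2r ?prime_gt1.
have sF k : size (F k.+1) = n.+1 by apply: size_poly_eq; rewrite cn.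
have Fm k : F k.+1 \is monic by rewrite monicE lead_coefE sF Fi cn.
have FD k : exists D, F k.+2 = F k.+1 + (p ^ k.+1)%:Z *: D.
  exists (\poly_(i < n.+1) (monic_coef p c i k.+2 %/ p ^ k.+1)%:Z).
  apply/polyP => i; rewrite coefD coefZ !coef_poly; case: ifP => _; last by rewrite mulr0 addr0.
  rewrite -(mcp i k.+1).2 -PoszM -PoszD; congr Posz.
  by rewrite mulnC addnC -divn_eq.
have F1 : map_poly (intr : int -> 'F_p) (F 1%N) = a * b.
  rewrite -fE; apply/polyP => i.
  by rewrite coef_monic_poly_of_reduction // coef_map /= Fi -pmulrn.
have [G [H GH]] := hensel p pp n a b F am bm cop sab Fm sF FD F1.
(* The residue modulo [p ^ k] comes from lift [k.-1], which is correct to that precision. For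
   [k = 0] the modulus is 1 and the residue is 0 whatever the lift. *)
pose res (G : nat -> {poly int}) i k := `|((G k.-1)`_i %% (p ^ k)%:Z)%Z|%N.
have pk k : (p ^ k)%:Z != 0 by rewrite eqz_nat expn_eq0 negb_and -lt0n p0.
have resE G' i k : (res G' i k)%:Z = ((G' k.-1)`_i %% (p ^ k)%:Z)%Z.
  by rewrite /res gez0_abs // modz_ge0.
have res_padic (G' : nat -> {poly int}) i :
    (forall k, exists U, G' k.+1 = G' k + (p ^ k.+1)%:Z *: U) -> is_padic p (res G' i).
  move=> GU k; split.
    by rewrite -ltz_nat resE ltz_pmod // ltz_nat expn_gt0 p0.
  apply/eqP; rewrite -eqz_nat -modz_nat !resE; apply/eqP.
  case: k => [|k]; first by rewrite expn0 !modz1.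
  have [U GkE] := GU k; set z := (G' k.+1)`_i.
  have -> : (z %% (p ^ k.+2)%:Z)%Z = - (z %/ (p ^ k.+2)%:Z)%Z * p%:Z * (p ^ k.+1)%:Z + z.
    rewrite {3}(divz_eq z (p ^ k.+2)%:Z) -mulrA -PoszM -expnS; ring.
  by rewrite modzMDl /z GkE coefD coefZ addrC mulrC modzMDl.
pose mk (G : nat -> {poly int}) := mkseq (res G) n.+1.
have mkE (G' : nat -> {poly int}) i : (forall k, (size (G' k) <= n.+1)%N) ->
    pcoef (mk G') i = res G' i.
  move=> sG; rewrite /pcoef /mk; have [ni|ni] := ltnP i n.+1; first by rewrite nth_mkseq.
  rewrite nth_default ?size_mkseq //; apply/funext => k; rewrite /res nth_default ?mod0z //.
  exact: leq_trans (sG _) ni.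
have sG k : size (G k) = size a by have [Gm _ <- _ _] := GH k; rewrite size_red_monic.
have sH k : size (H k) = size b by have [_ Hm _ <- _] := GH k; rewrite size_red_monic.
have sGn k : (size (G k) <= n.+1)%N by rewrite sG; lia.
have sHn k : (size (H k) <= n.+1)%N by rewrite sH; lia.
(* The leading coefficient is 1 in every lift, so its residue modulo [p] is nonzero. *)
have nonc (G' : nat -> {poly int}) m : (1 < m)%N -> (forall k, (size (G' k) <= n.+1)%N) ->
    (forall k, size (G' k) = m) -> (forall k, G' k \is monic) -> padic_poly_nonconst (mk G').
  move=> m1 sn sm mon; exists m.-1; split; first by lia.
  rewrite mkE // => /(_ 1%N) /eqP; rewrite -eqz_nat resE expn1 /=.
  have := monicP (mon 0%N); rewrite lead_coefE sm => ->.
  by rewrite modz_small // ltz_nat prime_gt1.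
exists (mk G), (mk H); split.
- by move=> i; rewrite mkE //; apply: res_padic => k; have [_ _ _ _ []] := GH k.
- by move=> i; rewrite mkE //; apply: res_padic => k; have [_ _ _ _ []] := GH k.
- by apply: (nonc _ (size a)) => // k; have [] := GH k.
- by apply: (nonc _ (size b)) => // k; have [] := GH k.
move=> i k; case: k => [|k].
  by rewrite /pmul_coef expn0 modn1; have := (mcp i 0%N).1; rewrite expn0 ltnS leqn0 => /eqP.
rewrite /pmul_coef -[LHS](modn_small (mcp i k.+1).1).
apply/eqP; rewrite -eqz_nat -!modz_nat; apply/eqP; rewrite -Fi.
have [_ _ _ _ [[E ->] _ _]] := GH k.
rewrite coefD coefZ addrC mulrC modzMDl coefM; apply/eqP.
rewrite eqz_mod_dvd (big_morph Posz PoszD (erefl _)) -sumrB.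
apply: rpred_sum => j _; rewrite PoszM !mkE // !resE /=.
by rewrite -[_ \in _]/(_ %| _)%Z -eqz_mod_dvd modzMml modzMmr.
Qed.

(** * Digits and measure *)

(** With [e = n - j.+1], [x * p ^ n] is [x * p ^ j.+1] scaled by [p ^ e], so the floor of the latter
    is the integer quotient of [t] by [p ^ e]. *)
Lemma pdigit_floor (R : realType) (p n j t : nat) (x : R) : (0 < p)%N ->
  (j < n)%N -> Num.floor (x * (p ^ n)%:R) = t%:Z ->
  pdigit p x j = ((t %/ p ^ (n - j.+1)) %% p)%N.
Proof.
move=> p0 jn xt; rewrite /pdigit; set e := (n - j.+1)%N.
have ne : (p ^ n)%N = (p ^ j.+1 * p ^ e)%N by rewrite -expnD subnKC.
have d0 : (0 < (p ^ e)%:R :> R) by rewrite ltr0n expn_gt0 p0.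
have := floor_itv (x * (p ^ n)%:R); rewrite xt ne natrM mulrA => /andP[h1 h2].
suff -> : Num.floor (x * p%:R ^+ j.+1) = (t %/ p ^ e)%:Z by rewrite modz_nat absz_nat.
apply: floor_def; rewrite -natrX; apply/andP; split.
  rewrite -(ler_pM2r d0); apply: le_trans h1.
  by rewrite -!pmulrn -natrM ler_nat leq_divM.
rewrite -(ltr_pM2r d0); apply: (lt_le_trans h2).
rewrite !intrD -!pmulrn -!natrD -natrM ler_nat !addn1.
by rewrite -ltn_divLR ?expn_gt0 ?p0 //.
Qed.

(* The base-[p] digits of [t < p ^ n], most significant first: these are the
   first [n] digits of every real [x] with floor (x * p ^ n) = t. *)
Definition digit_row (p n : nat) (t : nat) : 'rV['F_p]_n :=
  \row_j (t %/ p ^ (n - j.+1))%:R.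

(** The quotients by [p ^ (n - j)] are recovered one digit at a time as [j] grows. By cardinality
    this makes the residue vectors equidistributed. *)
Lemma digit_row_inj p n : prime p ->
  injective (fun t : 'I_(p ^ n) => digit_row p n t).
Proof.
move=> pp t t' tt'.
suff h j : (j <= n)%N -> (t %/ p ^ (n - j) = t' %/ p ^ (n - j))%N.
  by apply: val_inj; have := h n (leqnn n); rewrite subnn !divn1.
elim: j => [|j IH] jn; first by rewrite subn0 !divn_small.
have e : (p ^ (n - j))%N = (p ^ (n - j.+1) * p)%N by rewrite -expnSr subnSK.
rewrite (divn_eq (t %/ p ^ (n - j.+1)) p) (divn_eq (t' %/ p ^ (n - j.+1)) p).
rewrite -!divnMA -e IH ?(ltnW jn) //; congr (_ + _)%N.
have /rowP/(_ (Ordinal jn)) := tt'; rewrite !mxE /=.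
by move=> /(congr1 (fun z : 'F_p => z : nat)); rewrite !val_Fp_nat.
Qed.

Lemma is_padic_digits (R : realType) p n (x : R) j : (0 < p)%N ->
  is_padic p (@digits_to_coefs R p n x j).
Proof.
move=> p0.
have lt k : (@digits_to_coefs R p n x j k < p ^ k)%N.
  rewrite /digits_to_coefs; elim: k => [|k IH]; first by rewrite big_ord0.
  rewrite big_ord_recr /= expnS.
  have : (pdigit p x (k * n + j) < p)%N.
    by rewrite -ltz_nat gez0_abs ?modz_ge0 ?ltz_pmod // eqz_nat -lt0n.
  move=> dp; apply: (@leq_trans ((pdigit p x (k * n + j)).+1 * p ^ k)).
    by rewrite mulSn ltn_add2r.
  by rewrite leq_mul2r dp orbT.
move=> k; split; first exact: lt.
rewrite /digits_to_coefs big_ord_recr /= addnC modnMDl.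
by rewrite modn_small //; apply: lt.
Qed.

(** Digit [m] of coefficient [j] sits at position [m * n + j], so the residues modulo [p], given by
    [m = 0], are the first [n] digits of [x]. *)
Lemma reduction_digits (R : realType) p n (x : R) (t : nat) : prime p ->
  Num.floor (x * (p ^ n)%:R) = t%:Z ->
  reduction p n (@digits_to_coefs R p n x) = digit_row p n t.
Proof.
move=> pp xt; apply/rowP => j; rewrite !mxE /digits_to_coefs big_ord1 muln1.
by rewrite mul0n add0n (@pdigit_floor R p n j t) ?prime_gt0 // Fp_nat_mod.
Qed.

(** * Residue classes of irreducibles and of proper powers *)

Definition irred_rows (p n : nat) : {set 'rV['F_p]_n} :=
  [set v | `[< irreducible_poly (monic_poly_of _ n v) >]].

Definition power_rows (p n : nat) : {set 'rV['F_p]_n} :=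
  [set v | `[< exists (q : {poly 'F_p}) (m : nat),
    [/\ irreducible_poly q, q \is monic, (1 < m)%N & monic_poly_of _ n v = q ^+ m] >]].

(** A proper power is determined by the degree [d <= n./2] of its base [q] and by the lower
    coefficients of [q], since the exponent is [n %/ d]. *)
Lemma card_power_rows p n : prime p ->
  (#|power_rows p n| <= n.+1 * p ^ n./2)%N.
Proof.
move=> pp; pose h := n./2.
(* Coefficient vectors are padded to length [h] to have one type for all degrees. The values at
   degree 0 are harmless, since only covering [power_rows] matters. *)
pose f (x : 'I_h.+1 * 'rV['F_p]_h) : 'rV['F_p]_n :=
  poly_rV (('X^(x.1) + rVpoly x.2) ^+ (n %/ x.1) - 'X^n).
have sub : power_rows p n \subset [set f x | x : 'I_h.+1 * 'rV['F_p]_h].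
  apply/fintype.subsetP => v; rewrite inE => /asboolP[q [m [iq mq m1 vE]]].
  pose d := (size q).-1; have q1 : (1 < size q)%N := iq.1.
  have sq : size q = d.+1 by rewrite /d; case: (size q) q1.
  have d0 : (0 < d)%N by rewrite sq in q1.
  have nE : n = (d * m)%N.
    by have := size_exp q m; rewrite -vE size_monic_poly_of.
  have dh : (d < h.+1)%N by rewrite /h nE; nia.
  have [w wE] : exists w : 'rV['F_p]_h, 'X^d + rVpoly w = q.
    have [u <-] := monic_poly_of_surj _ _ _ mq sq.
    exists (poly_rV (rVpoly u)); rewrite poly_rV_K //.
    by rewrite (leq_trans (size_poly _ _)).
  apply/imsetP; exists (Ordinal dh, w) => //.
  have md : (n %/ d = m)%N by rewrite {1}nE mulKn.
  rewrite /f /= wE md -vE.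
  by rewrite /monic_poly_of addrAC subrr add0r rVpolyK.
apply: leq_trans (subset_leq_card sub) _; apply: leq_trans (leq_imset_card _ _) _.
rewrite card_prod card_ord card_mx card_Fp // mul1n leq_mul2r.
by apply/orP; right; rewrite /h; lia.
Qed.

Local Open Scope classical_set_scope.

(* No measurability is assumed: on an arbitrary set [lebesgue_measure] takes the
   value of the outer measure. *)
Lemma lebesgue_measure_le (R : realType) (A B : set R) :
  A `<=` B -> (lebesgue_measure A <= lebesgue_measure B)%E.
Proof. by move=> AB; rewrite /lebesgue_measure; apply: le_mu_ext. Qed.

Lemma floor_fiberE (R : realType) (q : nat) (z : int) : (0 < q)%N ->
  [set x : R | Num.floor (x * q%:R) = z] =
  `[z%:~R / q%:R, (z + 1)%:~R / q%:R[.
Proof.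
move=> q0; have q0' : 0 < q%:R :> R by rewrite ltr0n.
apply/seteqP; split => x /=; rewrite in_itv /= ler_pdivrMr // ltr_pdivlMr //.
  by move=> <-; exact: floor_itv.
exact: floor_def.
Qed.

(** The fibres are disjoint half-open intervals of length [1 / q]. *)
Lemma lebesgue_measure_floor_fibers (R : realType) (q : nat) (T : {set 'I_q}) :
  (0 < q)%N ->
  lebesgue_measure
    [set x : R | exists2 t : 'I_q, t \in T & Num.floor (x * q%:R) = t%:Z] =
  (#|T|%:R / q%:R)%:E.
Proof.
move=> q0; have q0' : 0 < q%:R :> R by rewrite ltr0n.
pose I (t : 'I_q) := [set x : R | Num.floor (x * q%:R) = t%:Z].
have mI t : measurable (I t).
  by rewrite /I floor_fiberE //; exact: measurable_itv.
have muI t : lebesgue_measure (I t) = (q%:R^-1)%:E.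
  rewrite /I floor_fiberE // lebesgue_measure_itv /= lte_fin.
  rewrite ltr_pM2r ?invr_gt0 // ltr_int ltzD1 lexx.
  by rewrite -EFinB -mulrBl intrD addrAC subrr add0r mul1r.
have -> : [set x : R | exists2 t : 'I_q, t \in T & Num.floor (x * q%:R) = t%:Z]
    = \bigcup_(t in [set` enum T]) I t.
  apply/seteqP; split => x /= [t tT xt]; exists t => //.
    by rewrite /= mem_enum.
  by rewrite /= mem_enum in tT.
have tI : trivIset [set` enum T] I.
  by move=> i j _ _ [x []]; rewrite /I /= => -> [/val_inj].
rewrite measure_fin_bigcup; [|exact: finite_finset|exact: tI|by move=> *; exact: mI].
rewrite -fsbig_seq ?enum_uniq //= big_enum /=.
rewrite (eq_bigr (fun=> (q%:R^-1)%:E)) => [|t _]; last exact: muI.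
by rewrite sumEFin sumr_const mulr_natl.
Qed.

(** A reduction that is not a power of an irreducible splits into coprime nonconstant factors, and
    Hensel's lemma lifts the splitting. *)
Lemma irred_set_sub (R : realType) p n : prime p -> (0 < n)%N ->
  irred_set p n `<=` [set x : R | exists2 t : 'I_(p ^ n),
    t \in (fun t : 'I_(p ^ n) => digit_row p n t) @^-1: (irred_rows p n :|: power_rows p n)%SET
    & Num.floor (x * (p ^ n)%:R) = t%:Z].
Proof.
move=> pp n0 x [/andP[x0 x1] irr]; have p0 := prime_gt0 pp.
have q0 : (0 < (p ^ n)%:R :> R) by rewrite ltr0n expn_gt0 p0.
have : 0 <= Num.floor (x * (p ^ n)%:R) by rewrite floor_ge_int mulr_ge0 // ltW.
case xt : (Num.floor _) => [t|//] _.
have tq : (t < p ^ n)%N.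
  rewrite -ltz_nat -xt floor_lt_int -[ltRHS]mul1r ltr_pM2r //.
exists (Ordinal tq) => //; rewrite !inE -(reduction_digits R p n x t pp xt).
set f := monic_poly_of _ _ _.
have fm : f \is monic := monic_poly_of_monic _ _ _.
have sf : size f = n.+1 := size_monic_poly_of _ _ _.
have [|[a [b [am bm cop /andP[a1 b1] fE]]]|[q [m [iq mq fE]]]] :=
    monic_coprime_factorization _ f fm; first by rewrite sf.
  exfalso; apply: irr; apply: (hensel_reducible p n _ a b) => //.
  by move=> j; apply: is_padic_digits.
(* Exponent 0 contradicts [0 < n], exponent 1 is the irreducible case, and larger exponents give
   [power_rows]. *)
case: m fE => [|[|m]] fE.
- by move: sf n0; rewrite fE expr0 size_poly1 => -[<-].
- by apply/orP; left; apply/asboolP; rewrite -/f fE expr1.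
- by apply/orP; right; apply/asboolP; exists q, m.+2.
Qed.

Lemma sub_irred_set (R : realType) p n : prime p ->
  [set x : R | exists2 t : 'I_(p ^ n),
    t \in (fun t : 'I_(p ^ n) => digit_row p n t) @^-1: irred_rows p n
    & Num.floor (x * (p ^ n)%:R) = t%:Z] `<=` irred_set p n.
Proof.
move=> pp x [t]; rewrite !inE => /asboolP irr xt.
have q0 : (0 < (p ^ n)%:R :> R) by rewrite ltr0n expn_gt0 prime_gt0.
have := floor_itv (x * (p ^ n)%:R); rewrite xt => /andP[h1 h2]; split.
  apply/andP; split.
    by rewrite -(pmulr_lge0 _ q0); apply: le_trans h1.
  rewrite -(ltr_pM2r q0) mul1r; apply: (lt_le_trans h2).
  by rewrite intrD -!pmulrn -natrD ler_nat addn1.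
move=> red; apply: (monic_reducible_modp p n _ pp red).
by rewrite (reduction_digits R p n x t pp xt); apply/asboolP; exact: irr.
Qed.

Local Close Scope classical_set_scope.

(** * The final estimate *)

Theorem theorem1 (R : realType) (n : nat) (hn : (1 <= n)%N) :
  exists C : R, 0 < C /\
    forall p : nat, prime p -> ~~ (p %| n)%N ->
      (`| prop_irred (R := R) p n - (n%:R^-1)%:E | <=
         (C / Num.sqrt (p%:R ^+ n))%:E)%E.
Proof.
(* The constant is the factor in the bound on [power_rows]; the error in the lower bound needs only
   the factor 1. *)
exists n.+1%:R; split => [|p pp _]; first by rewrite ltr0n.
pose q := (p ^ n)%N; pose h := (p ^ n./2)%N.
have q0 : (0 < q)%N by rewrite expn_gt0 prime_gt0.
have bij : bijective (fun t : 'I_q => digit_row p n t).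
  apply: inj_card_bij; first exact: digit_row_inj.
  by rewrite card_mx card_Fp // mul1n card_ord.
have preim (A : {set 'rV['F_p]_n}) :
    #|(fun t : 'I_q => digit_row p n t) @^-1: A| = #|A|.
  by apply: on_card_preimset; apply: onW_bij.
pose N := #|irred_rows p n|.
have lo : ((N%:R / q%:R)%:E <= prop_irred (R := R) p n)%E.
  rewrite /N -preim -lebesgue_measure_floor_fibers //.
  by apply: lebesgue_measure_le; apply: sub_irred_set.
have up : (prop_irred (R := R) p n <= ((N + n.+1 * h)%:R / q%:R)%:E)%E.
  apply: (@le_trans _ _ (#|(irred_rows p n :|: power_rows p n)%SET|%:R / q%:R)%:E).
    rewrite -preim -lebesgue_measure_floor_fibers //.
    by apply: lebesgue_measure_le; apply: irred_set_sub.
  rewrite lee_fin ler_pM2r ?invr_gt0 ?ltr0n // ler_nat.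
  apply: leq_trans (leq_card_setU _ _) _; rewrite leq_add2l.
  exact: card_power_rows.
have N1 : (n * N <= q)%N.
  have := card_irred_monic_le 'F_p n (irred_rows p n) hn; rewrite card_Fp //.
  by apply=> v; rewrite inE => /asboolP.
have N2 : (q <= n * N + n * h)%N.
  apply: card_irred_monic_ge => // v; rewrite inE => iv; exact/asboolP.
(* Since [n./2] rounds down, [h] is at most the square root of [q]. *)
have hq : (h * h <= q)%N by rewrite -expnD leq_exp2l ?prime_gt1 //; lia.
have qR : 0 < q%:R :> R by rewrite ltr0n.
rewrite -natrX -/q; set s := Num.sqrt _.
have s0 : 0 < s by rewrite sqrtr_gt0.
have ss : s * s = q%:R by rewrite -expr2 sqr_sqrtr // ltW.
have hs : h%:R <= s.
  rewrite -(ler_pXn2r (n := 2)) ?nnegrE ?ler0n ?(ltW s0) //.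
  by rewrite !expr2 ss -natrM ler_nat.
have nR : 0 < n%:R :> R by rewrite ltr0n.
have bnd : h%:R / q%:R <= s^-1.
  by rewrite -ss invfM mulrA ler_pdivrMr // mulVf ?gt_eqF // ler_pdivrMr // mul1r.
have {}N1 : N%:R / q%:R <= n%:R^-1 :> R.
  by rewrite ler_pdivrMr // ler_pdivlMl // -natrM ler_nat.
have {}N2 : n%:R^-1 - h%:R / q%:R <= N%:R / q%:R :> R.
  rewrite lerBlDr -mulrDl ler_pdivlMr // ler_pdivrMl // -natrD -natrM ler_nat.
  by rewrite mulnDr.
(* The two real bounds exclude infinite values, so the rest is real arithmetic. *)
case: (prop_irred p n) lo up => [r| |] //; rewrite !lee_fin => lo up.
rewrite ler_norml.
have n1 : 1 <= n.+1%:R :> R by rewrite ler1n.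
have s1 : s^-1 <= n.+1%:R / s by rewrite ler_peMl // invr_ge0 ltW.
have up' : r <= n%:R^-1 + n.+1%:R / s.
  apply: le_trans up _; rewrite natrD mulrDl natrM -mulrA lerD //.
  by rewrite ler_wpM2l.
by apply/andP; split; lra.
Qed.
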